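(* Let $K,L$ be integers with $1\le L\le K$, let $d=2K$, and let $\lambda<d$. Let $V$ be a set of $n$ processes and let $F\subseteq V$, nonempty with $|F|=\beta n$, be the set of faulty processes. Consider the round-based removal process described in the context, started from $(V_0,F_0)=(V,F)$, and assume that in every round $r$ the monitoring multigraph $G_r$ on $V_r$ has second eigenvalue bounded by $\lambda$. (1) If $$\beta<1-\frac{L}{K}-\frac{\lambda}{d},$$ then in each round with $F_r\neq\emptyset$ at least one process of $F_r$ is removed, and hence the process eventually removes all of $F$. (2) If, for some $\epsilon>0$, $$\beta<1-\frac{L}{K}-\frac{\lambda}{d}-\epsilon,$$ then in each round with $F_r\ne\emptyset$ at least a constant fraction (depending only on $\epsilon$) of the processes in $F_r$ is removed, and hence all of $F$ is removed within $O(1+\log|F|)$ rounds, where the implied constant depends only on $\epsilon$.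
   Context: Monitoring topology: for a finite set $W$ of at least two processes and an integer $K\ge1$, a $K$-ring topology on $W$ consists of $K$ rings, each a cyclic ordering of all of $W$. If $o$ immediately precedes $s$ in a ring, then $o$ is an observer of $s$ in that ring. Repetitions over different rings are counted with multiplicity, so each process has exactly $K$ observers with multiplicity. The monitoring multigraph on $W$ is the undirected multigraph with one edge between $o$ and $s$ for each (ring, observer/subject pair $(o,s)$); it is $d=2K$ regular. ''Its second eigenvalue is bounded by $\lambda$'' means that every eigenvalue of its adjacency matrix (entries are edge multiplicities), other than one copy of the largest eigenvalue $d$, is at most $\lambda$ in absolute value. Removal process: in round $r=0,1,2,\dots$ the current membership is $V_r$ and the set of remaining faulty processes is $F_r\subseteq V_r$. As long as $F_r\neq\emptyset$, a $K$-ring topology on $V_r$ is given, with monitoring multigraph $G_r$. Let $T_r\subseteq F_r$ be the set of processes in $F_r$ having at least $L$ observers (with multiplicity) in $V_r\setminus F_r$, i.e. at least $L$ of whose $K$ observers are non-faulty. The processes of $T_r$ are detected as failed and removed: $V_{r+1}=V_r\setminus T_r$ and $F_{r+1}=F_r\setminus T_r$. The topology on $V_{r+1}$ may be an arbitrary new $K$-ring topology, subject to the eigenvalue assumption. *)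

(* Defs.v *)
From mathcomp Require Import all_boot all_order all_algebra.
From mathcomp Require Import reals exp.

Set Implicit Arguments.
Unset Strict Implicit.
Unset Printing Implicit Defensive.

Import Order.TTheory GRing.Theory Num.Theory.

Section Topology.
Context {T : finType} {K : nat}.

(* A cyclic ordering is given by a duplicate-free enumeration, read
   cyclically; [t k] is the k-th ring. *)
Definition ring_topology (W : {set T}) (t : 'I_K -> seq T) : Prop :=
  (2 <= #|W|)%N /\ forall k : 'I_K, uniq (t k) /\ t k =i W.

Definition observer (t : 'I_K -> seq T) (k : 'I_K) (s : T) : T :=
  prev (t k) s.

(* The first summand counts the rings in which x observes y, the second those
   in which y observes x; with two processes both happen in every ring. *)
Definition edge_mult (t : 'I_K -> seq T) (x y : T) : nat :=
  #|[set k | observer t k y == x]| + #|[set k | observer t k x == y]|.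

(* Rows and columns are indexed by the processes of W only, so that no spurious
   zero eigenvalues come from the elements of T outside W. *)
Definition adjacency (R : realType) (W : {set T}) (t : 'I_K -> seq T) :
    'M[R]_#|W| :=
  (\matrix_(i, j) (edge_mult t (enum_val i) (enum_val j))%:R)%R.

(* [W] is the membership and [F] the set of remaining faulty processes. *)
Definition detected (L : nat) (W F : {set T}) (t : 'I_K -> seq T) : {set T} :=
  [set s in F | (L <= #|[set k | observer t k s \in W :\: F]|)%N].

(* The pair (V_r, F_r). Once F_r is empty nothing is detected, whatever the
   value of [t r], so the process is stationary from then on. *)
Fixpoint state (L : nat) (V F : {set T}) (t : nat -> 'I_K -> seq T) (r : nat) :
    {set T} * {set T} :=
  if r is r'.+1 then
    let: (W, F') := state L V F t r' in
    (W :\: detected L W F' (t r'), F' :\: detected L W F' (t r'))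
  else (V, F).

Definition members L V F t r : {set T} := (state L V F t r).1.
Definition faulty L V F t r : {set T} := (state L V F t r).2.
Definition removed L V F t r : {set T} :=
  detected L (members L V F t r) (faulty L V F t r) (t r).

End Topology.

Local Open Scope ring_scope.

(* All eigenvalues of [A], other than one copy of [d], are at most [lam] in
   absolute value; [d] itself is subject to the bound only if its multiplicity
   exceeds 1. *)
Definition second_eigenvalue_bounded (R : realType) (n : nat) (A : 'M[R]_n)
    (d lam : R) : Prop :=
  forall x : R, eigenvalue A x ->
    x <> d \/ (1 < mup x (char_poly A))%N -> `|x| <= lam.

Definition topologies_ok (R : realType) (T : finType) (K L : nat) (lam : R)
    (V F : {set T}) (t : nat -> 'I_K -> seq T) : Prop :=
  forall r : nat, faulty L V F t r != set0 ->
    ring_topology (members L V F t r) (t r) /\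
    second_eigenvalue_bounded (adjacency R (members L V F t r) (t r))
      (2 * K)%:R lam.

(* Main.v *)
(* If X is the current faulty set, of size x in a membership of size w, the
   expander mixing lemma bounds the number of (ring, subject) pairs inside X by
   x (K x/w + lambda/2). Each undetected process of X contributes at least
   K - L + 1 such pairs. Since x/w never exceeds beta, this forces the detected
   processes to be more than eps x in number. So |F_r| <= exp(-eps r) |F|, which
   is below 1 for some r <= 1 + ln|F| / eps. The mixing lemma comes from the
   spectral theorem for the adjacency matrix viewed over R[i]: as lambda < d, the
   eigenvalue d is simple, hence the constant vector is orthogonal to all other
   eigenvectors. *)
Require Import Defs.
From mathcomp Require Import all_boot all_order all_algebra.
From mathcomp Require Import spectral sesquilinear complex.
From mathcomp Require Import ring lra zify.
From mathcomp Require Import reals sequences exp.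

Set Implicit Arguments.
Unset Strict Implicit.
Unset Printing Implicit Defensive.

Import Order.TTheory GRing.Theory Num.Theory.
Local Open Scope ring_scope.

(** * Spectral theorem and the expander mixing lemma *)

Section Mixing.
Local Open Scope sesquilinear_scope.

Lemma char_poly_conj (F : fieldType) (n : nat) (P A : 'M[F]_n) :
  P \in unitmx -> char_poly (invmx P *m A *m P) = char_poly A.
Proof.
move=> Pu; rewrite /char_poly.
have -> : char_poly_mx (invmx P *m A *m P) =
    map_mx polyC (invmx P) *m char_poly_mx A *m map_mx polyC P.
  rewrite /char_poly_mx mulmxBr mulmxBl -!map_mxM; congr (_ - _).
  by rewrite scalar_mxC -mulmxA -map_mxM mulVmx // map_mx1 mulmx1.
by rewrite !det_mulmx mulrAC -det_mulmx -map_mxM mulVmx // map_mx1 det1 mul1r.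
Qed.

Lemma char_poly_diag (F : comNzRingType) (n : nat) (D : 'rV[F]_n) :
  char_poly (diag_mx D) = \prod_(i < n) ('X - (D 0 i)%:P).
Proof.
rewrite char_poly_trig ?diag_mx_is_trig //.
by apply: eq_bigr => i _; rewrite mxE eqxx.
Qed.

(** Over [R[i]] the matrix is hermitian, so its spectral diagonal is real. The factorisation of
    [char_poly A] is pulled back to [R] along the injective embedding; it identifies multiplicities
    of eigenvalues with repetitions in [x]. *)
Lemma realsym_spectral (R : rcfType) (n : nat) (A : 'M[R]_n) :
  A^T = A ->
  exists (P : 'M[R[i]]_n) (x : 'rV[R]_n),
    [/\ P \is unitarymx,
        map_mx (real_complex R) A
          = P^t* *m diag_mx (map_mx (real_complex R) x) *m P
      & char_poly A = \prod_(i < n) ('X - (x 0 i)%:P)].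
Proof.
move=> symA; pose B := map_mx (real_complex R) A.
have hB : B \is hermsymmx.
  apply: realsym_hermsym.
    by apply/is_hermitianmxP; rewrite expr0 scale1r map_mx_id // map_trmx symA.
  by apply/mxOverP => i j; rewrite mxE complex_real.
have /orthomx_spectralP BE := hermitian_normalmx hB.
have /mxOverP Dr := hermitian_spectral_diag_real hB.
pose x := map_mx (@complex.Re R) (spectral_diag B).
have xE : spectral_diag B = map_mx (real_complex R) x.
  by apply/matrixP => i j; rewrite !mxE [RHS]RRe_real.
exists (spectralmx B), x; split.
- exact: spectral_unitarymx.
- by rewrite -invmx_unitary ?spectral_unitarymx // -xE -BE.
apply: (map_inj_poly (@complexI R)) => //.
rewrite map_char_poly -/B BE char_poly_conj ?spectral_unit //.
rewrite char_poly_diag rmorph_prod; apply: eq_bigr => i _.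
by rewrite rmorphB /= map_polyX map_polyC xE mxE.
Qed.

Lemma mup_prod_XsubC_gt1 (F : fieldType) (n : nat) (x : 'I_n -> F) (i j : 'I_n) :
  i != j -> x i = x j ->
  (1 < mup (x i) (\prod_(k < n) ('X - (x k)%:P)))%N.
Proof.
move=> ij xij; rewrite mup_geq ?(monic_neq0 (monic_prod_XsubC _ _ _)) //.
rewrite (bigD1 i) //= (bigD1 j) 1?eq_sym //= -xij mulrA -expr2.
exact: dvdp_mulr.
Qed.

Lemma sqr_norm_row (C : numClosedFieldType) (n : nat) (u : 'rV[C]_n) (x : 'rV[C]_n) :
  (u *m diag_mx x *m u^t*) 0 0 = \sum_(i < n) x 0 i * `|u 0 i| ^+ 2.
Proof.
rewrite mxE; apply: eq_bigr => i _.
by rewrite mul_mx_diag !mxE normCK mulrAC mulrC.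
Qed.

(** In eigenbasis coordinates the all-ones vector is supported on the single index [i0] of
    eigenvalue [d]. That coordinate of [u] therefore carries exactly the squared coordinate sum
    divided by [n], and every other coordinate is weighted by at most [lam]. *)
Lemma unitary_diag_mixing (C : numClosedFieldType) (n : nat) (P : 'M[C]_n)
    (x : 'rV[C]_n) (d lam : C) (u : 'rV[C]_n) :
  P \is unitarymx -> (0 < n)%N ->
  const_mx 1 *m (P^t* *m diag_mx x *m P) = d *: (const_mx 1 : 'rV_n) ->
  {in [pred i | x 0 i == d] &, forall i j, i = j} ->
  (forall i, x 0 i != d -> x 0 i <= lam) ->
  (u *m (P^t* *m diag_mx x *m P) *m u^t*) 0 0 * n%:R <=
    (d - lam) * `|\sum_i u 0 i| ^+ 2 + lam * (\sum_i `|u 0 i| ^+ 2) * n%:R.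
Proof.
move=> Pu n0 regA uniqd xle.
have PPV : P *m P^t* = 1%:M by apply/unitarymxP.
have PVP : P^t* *m P = 1%:M by exact: mulmx1C.
set J : 'rV[C]_n := const_mx 1.
(* [c v] is the coordinate row of [v] in the orthonormal basis formed by the rows of [P]; [dotE] is
   Parseval's identity. *)
pose c (v : 'rV[C]_n) := v *m P^t*.
have dotE v w : \sum_i c v 0 i * (c w 0 i)^* = \sum_i v 0 i * (w 0 i)^*.
  transitivity ((c v *m (c w)^t*) 0 0).
    by rewrite mxE; apply: eq_bigr => i _; rewrite !mxE.
  rewrite trmx_mul map_mxM trmxCK -mulmxA (mulmxA _ P) PVP mul1mx mxE.
  by apply: eq_bigr => i _; rewrite !mxE.
have normE v : \sum_i `|c v 0 i| ^+ 2 = \sum_i `|v 0 i| ^+ 2.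
  under eq_bigr do rewrite normCK; rewrite dotE.
  by apply: eq_bigr => i _; rewrite normCK.
have cJd i : c J 0 i != 0 -> x 0 i = d.
  move=> cJi; apply: (mulfI cJi).
  have : c J *m diag_mx x = d *: c J.
    by rewrite /c scalemxAl -regA -!mulmxA PPV mulmx1.
  by move/rowP/(_ i); rewrite mul_mx_diag !mxE => ->; rewrite mulrC.
have cJn : \sum_i `|c J 0 i| ^+ 2 = n%:R.
  rewrite normE; under eq_bigr do rewrite mxE normr1 expr1n.
  by rewrite sumr_const card_ord.
have [i0 cJi0] : exists i, c J 0 i != 0.
  apply/existsP; apply: contraTT n0 => /existsPn cJ0.
  suff /eqP : (n%:R : C) = 0 by rewrite pnatr_eq0 => /eqP ->.
  rewrite -cJn big1 // => i _.
  by have /negPn/eqP -> := cJ0 i; rewrite normr0 expr0n.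
have xi0 := cJd i0 cJi0.
have xne i : i != i0 -> x 0 i != d.
  by apply: contraNN => xid; apply/eqP/uniqd; rewrite ?inE ?xi0.
have cJ0 i : i != i0 -> c J 0 i = 0.
  by move=> /xne xd; apply/eqP; apply: contraNT xd => /cJd/eqP.
have cui0 : `|c u 0 i0| ^+ 2 * n%:R = `|\sum_i u 0 i| ^+ 2.
  rewrite -cJn (bigD1 i0) //= big1 ?addr0 => [|i /cJ0 ->]; last by rewrite normr0 expr0n.
  rewrite -exprMn -[X in _ * X]norm_conjC -normrM; congr (`|_| ^+ 2).
  transitivity (\sum_i c u 0 i * (c J 0 i)^*).
    by rewrite (bigD1 i0) //= big1 ?addr0 // => i /cJ0 ->; rewrite conjC0 mulr0.
  by rewrite dotE; apply: eq_bigr => i _; rewrite mxE conjC1 mulr1.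
have -> : (u *m (P^t* *m diag_mx x *m P) *m u^t*) 0 0
    = \sum_i x 0 i * `|c u 0 i| ^+ 2.
  by rewrite -sqr_norm_row /c trmx_mul map_mxM trmxCK !mulmxA.
rewrite -cui0 -normE (bigD1 i0) //= [X in _ + _ * X * _](bigD1 i0) //= xi0.
rewrite -subr_ge0.
set a := `|c u 0 i0| ^+ 2.
set S' := \sum_(i < n | i != i0) _; set S := \sum_(i < n | i != i0) _.
have -> : (d - lam) * (a * n%:R) + lam * (a + S') * n%:R - (d * a + S) * n%:R
    = (lam * S' - S) * n%:R by ring.
apply: mulr_ge0; last exact: ler0n.
rewrite subr_ge0 mulr_sumr; apply: ler_sum => i ii0.
by apply: ler_wpM2r; rewrite ?exprn_ge0 // xle ?xne.
Qed.

(* The expander mixing lemma for a single set, with a real vector in place of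
   the indicator function. *)
Lemma expander_mixing (R : realType) (n : nat) (A : 'M[R]_n) (d lam : R)
    (u : 'rV[R]_n) :
  (1 < n)%N -> A^T = A -> const_mx 1 *m A = d *: (const_mx 1 : 'rV_n) ->
  second_eigenvalue_bounded A d lam -> lam < d ->
  0 <= lam /\
  (u *m A *m u^T) 0 0 * n%:R <=
    (d - lam) * (\sum_i u 0 i) ^+ 2 + lam * (\sum_i u 0 i ^+ 2) * n%:R.
Proof.
move=> n1 symA regA sebA lamd.
have [P [x [Pu AE cpA]]] := realsym_spectral symA.
have eigx i : eigenvalue A (x 0 i).
  by rewrite eigenvalue_root_char cpA (bigD1 i) //= rootM root_XsubC eqxx.
have xle i : x 0 i != d -> `|x 0 i| <= lam.
  by move=> /eqP xd; apply: sebA (eigx i) _; left.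
(* A repeated [d] would itself be subject to the bound, giving [d <= lam] against [lam < d]. *)
have uniqd : {in [pred i | x 0 i == d] &, forall i j, i = j}.
  move=> i j /eqP xid /eqP xjd; apply/eqP.
  have : ~~ (`|d| <= lam) by rewrite -ltNge (lt_le_trans lamd) // ler_norm.
  apply: contraNT => ij; rewrite -xid; apply: sebA (eigx i) _; right.
  by rewrite cpA; apply: (@mup_prod_XsubC_gt1 _ _ (x 0) _ j); rewrite ?xid.
split.
  (* Of at least two indices only one can carry [d]; the absolute value of another eigenvalue forces
     [0 <= lam]. *)
  have [j xj] : exists j, x 0 j != d.
    apply/existsP; apply: contraTT n1 => /existsPn xd.
    rewrite -leqNgt -[n]card_ord; apply/card_le1P => i _ j.
    by rewrite !inE; apply/esym/eqP/uniqd; rewrite inE; apply/negPn.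
  exact: le_trans (normr_ge0 _) (xle j xj).
pose C : numClosedFieldType := R[i].
pose rc : {rmorphism R -> C} := real_complex R.
have rcle a b : (rc a <= rc b) = (a <= b) by exact: lecR.
have rcJ a : (rc a)^* = rc a by exact: conjc_real.
have rcn a : `|rc a| ^+ 2 = rc (a ^+ 2) by rewrite normCK rcJ rmorphXn.
have rc_inj : injective rc by exact: complexI.
have {}AE : map_mx rc A = (P : 'M[C]_n)^t* *m diag_mx (map_mx rc x) *m P by exact: AE.
have regC : const_mx 1 *m map_mx rc A = rc d *: (const_mx 1 : 'rV_n).
  by rewrite -(rmorph1 rc) -map_const_mx -map_mxM regA map_mxZ.
rewrite AE in regC.
have := @unitary_diag_mixing C n P _ _ (rc lam) (map_mx rc u) Pu (ltnW n1) regC.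
have uT : (map_mx rc u)^t* = map_mx rc u^T by apply/matrixP => i j; rewrite !mxE rcJ.
have s1 : `|\sum_i (map_mx rc u) 0 i| ^+ 2 = rc ((\sum_i u 0 i) ^+ 2).
  by rewrite -rcn rmorph_sum; congr (`|_| ^+ 2); apply: eq_bigr => i _; rewrite mxE.
have s2 : \sum_i `|(map_mx rc u) 0 i| ^+ 2 = rc (\sum_i u 0 i ^+ 2).
  by rewrite rmorph_sum; apply: eq_bigr => i _; rewrite mxE rcn.
rewrite -AE uT -!map_mxM mxE -!(rmorph_nat rc) s1 s2 -rmorphB -!rmorphM -rmorphD rcle.
apply.
  by move=> i j; rewrite !inE !mxE !(inj_eq rc_inj) => ? ?; apply: uniqd.
by move=> i; rewrite mxE (inj_eq rc_inj) rcle => /xle; apply/le_trans/ler_norm.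
Qed.

End Mixing.

(** * Counting observers in one round *)

Section Graph.
Context {T : finType} {K : nat}.
Implicit Types (W X F : {set T}) (t : 'I_K -> seq T).

Lemma sum_card_fibers X (f : 'I_K -> T) :
  (\sum_(x in X) #|[set k | f k == x]| = #|[set k | f k \in X]|)%N.
Proof.
rewrite -[RHS]sum1_card (partition_big f (mem X)) => [|k]; last by rewrite inE.
apply: eq_bigr => x xX; rewrite -sum1_card; apply: eq_bigl => k.
by rewrite !inE; case: eqP => [->|]; rewrite ?xX ?andbF.
Qed.

Lemma edge_multC t x y : edge_mult t x y = edge_mult t y x.
Proof. by rewrite /edge_mult addnC. Qed.

(** In each ring [y] has one observer, its predecessor, and one subject, its successor. *)
Lemma sum_edge_mult_regular W t y :
  ring_topology W t -> y \in W -> (\sum_(x in W) edge_mult t x y = 2 * K)%N.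
Proof.
move=> [_ tW] yW; rewrite big_split /= sum_card_fibers mul2n -addnn; congr addn.
  rewrite -[RHS]card_ord -cardsT; congr #|pred_of_set _|; apply/setP => k.
  by rewrite !inE -(tW k).2 mem_prev (tW k).2 yW.
transitivity (\sum_(k < K) #|[set x in W | observer t k x == y]|)%N.
  under eq_bigr do rewrite -sum1_card.
  rewrite (exchange_big_dep predT) //=; apply: eq_bigr => k _.
  by rewrite -sum1_card; apply: eq_bigl => x; rewrite !inE.
rewrite -[RHS]card_ord -sum1_card; apply: eq_bigr => k _.
suff -> : [set x in W | observer t k x == y] = [set next (t k) y] by rewrite cards1.
have [uk tkW] := tW k; apply/setP => x; rewrite !inE /observer.
apply/andP/eqP => [[_ /eqP <-]|->]; first by rewrite next_prev.
by rewrite prev_next // eqxx -tkW mem_next tkW yW.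
Qed.

Lemma sum_edge_mult X t :
  (\sum_(x in X) \sum_(y in X) edge_mult t x y =
   2 * \sum_(y in X) #|[set k | observer t k y \in X]|)%N.
Proof.
under eq_bigr do rewrite big_split /=.
rewrite big_split /= exchange_big /= mul2n -addnn.
by congr addn; apply: eq_bigr => x _; rewrite sum_card_fibers.
Qed.

(** This is the mixing lemma for the indicator vector of [X], whose quadratic form counts every
    observer/subject pair inside [X] twice. *)
Lemma internal_observers_le (R : realType) W X t (lam : R) :
  ring_topology W t -> X \subset W ->
  second_eigenvalue_bounded (adjacency R W t) (2 * K)%:R lam ->
  lam < (2 * K)%:R ->
  0 <= lam /\
  (2 * \sum_(s in X) #|[set k | observer t k s \in X]|)%:R * #|W|%:R <=
    ((2 * K)%:R - lam) * #|X|%:R ^+ 2 + lam * #|X|%:R * #|W|%:R.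
Proof.
move=> ringW XW seb lamd.
pose u : 'rV[R]_#|W| := \row_i (enum_val i \in X)%:R.
have sumX (f : T -> R) :
    \sum_(i < #|W|) (enum_val i \in X)%:R * f (enum_val i) = \sum_(x in X) f x.
  rewrite -(big_enum_val (fun x => (x \in X)%:R * f x)) [RHS]big_mkcond /=.
  rewrite [LHS]big_mkcond; apply: eq_bigr => x _.
  case: (boolP (x \in X)) => [xX|_]; last by rewrite mul0r if_same.
  by rewrite mul1r (subsetP XW).
have symA : (adjacency R W t)^T = adjacency R W t.
  by apply/matrixP => i j; rewrite !mxE edge_multC.
have regA : const_mx 1 *m adjacency R W t = (2 * K)%:R *: (const_mx 1 : 'rV_#|W|).
  apply/rowP => j; rewrite !mxE mulr1 -(sum_edge_mult_regular ringW (enum_valP j)).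
  rewrite natr_sum [RHS]big_enum_val; apply: eq_bigr => i _.
  by rewrite !mxE mul1r.
have [lam0 mixing] := expander_mixing u ringW.1 symA regA seb lamd.
split=> //.
have u1 : \sum_i u 0 i = #|X|%:R.
  rewrite -[in RHS]sum1_card natr_sum -sumX; apply: eq_bigr => i _.
  by rewrite mxE mulr1.
have u2 : \sum_i u 0 i ^+ 2 = #|X|%:R.
  rewrite -u1; apply: eq_bigr => i _; rewrite mxE.
  by case: (_ \in X); rewrite ?expr1n ?expr0n.
suff uAu : (u *m adjacency R W t *m u^T) 0 0 =
    (2 * \sum_(s in X) #|[set k | observer t k s \in X]|)%:R.
  by rewrite -uAu; move: mixing; rewrite u1 u2.
rewrite -sum_edge_mult natr_sum mxE.
transitivity (\sum_(y in X) \sum_(x in X) (edge_mult t x y)%:R : R); last first.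
  rewrite exchange_big /=.
  by apply: eq_bigr => x _; rewrite natr_sum.
rewrite -sumX; apply: eq_bigr => j _; rewrite [u^T _ _]mxE [u _ _]mxE mulrC; congr (_ * _).
by rewrite mxE -sumX; apply: eq_bigr => i _; rewrite !mxE.
Qed.

Lemma undetected_observers_le (L : nat) W F t :
  (forall k, t k =i W) -> F \subset W -> (L <= K)%N ->
  ((#|F| - #|detected L W F t|) * (K - L).+1 <=
     \sum_(s in F) #|[set k | observer t k s \in F]|)%N.
Proof.
move=> tW FW LK; have DF : detected L W F t \subset F by apply/subsetP => s; rewrite inE => /andP[].
rewrite (big_setID (detected L W F t)) /= -(cardsDS DF) -sum_nat_const.
apply: leq_trans (leq_addl _ _); apply: leq_sum => s.
rewrite !inE => /andP[]; case: (boolP (s \in F)) => //= sF; rewrite -ltnNge => good _.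
have := cardsC [set k | observer t k s \in F]; rewrite card_ord.
(* Observers of a member of [W] lie in [W], so one outside [F] is non-faulty. *)
suff -> : ~: [set k | observer t k s \in F] = [set k | observer t k s \in W :\: F].
  by move=> cK; rewrite ltn_subLR // -[ltnLHS]cK addnC ltn_add2r.
apply/setP => k; by rewrite !inE -(tW k) mem_prev tW (subsetP FW) ?andbT.
Qed.

(** Compares the upper and lower bounds on internal pairs. Strictness together with [0 <= eps]
    serves both parts: [eps = 0] already yields a detected process. *)
Lemma detected_gt (R : realType) (L : nat) W F t (lam b eps : R) :
  (1 <= L <= K)%N -> lam < (2 * K)%:R -> ring_topology W t ->
  F \subset W -> F != set0 ->
  second_eigenvalue_bounded (adjacency R W t) (2 * K)%:R lam ->
  #|F|%:R <= b * #|W|%:R -> 0 <= eps ->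
  b < 1 - L%:R / K%:R - lam / (2 * K)%:R - eps ->
  eps * #|F|%:R < #|detected L W F t|%:R.
Proof.
move=> /andP[L1 LK] lamd ringW FW F0 seb Fb eps0 blt.
have [lam0 mix] := internal_observers_le ringW FW seb lamd.
have := @undetected_observers_le L W F t (fun k => (ringW.2 k).2) FW LK.
set I := (\sum_(s in F) _)%N in mix *.
have : (#|detected L W F t| <= #|F|)%N.
  by apply: subset_leq_card; apply/subsetP => s; rewrite inE => /andP[].
set D := #|detected L W F t| => DF.
rewrite -(ler_nat R) natrM natrB // mulrS natrB // => lowI.
move: mix lamd blt; rewrite !natrM => mix lamd blt.
have K0 : 0 < K%:R :> R by rewrite ltr0n (leq_trans L1).
have L1' : 1 <= L%:R :> R by rewrite ler1n.
have x0 : 0 < #|F|%:R :> R by rewrite ltr0n card_gt0.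
have w0 : 0 < #|W|%:R :> R by rewrite ltr0n (leq_trans _ ringW.1).
have D0 : 0 <= D%:R :> R by rewrite ler0n.
have LK' : L%:R <= K%:R :> R by rewrite ler_nat.
(* The casts are generalised to real variables, leaving pure real inequalities. *)
move: mix lowI x0 w0 D0 LK' L1' Fb K0 lamd blt.
move: (#|F|%:R : R) (#|W|%:R : R) (D%:R : R) (I%:R : R) => x w dd i mix lowI.
move: (K%:R : R) (L%:R : R) mix lowI => k l mix lowI x0 w0 D0 LK' L1' Fb K0 lamd blt.
have b0 : 0 <= b.
  by rewrite -(pmulr_lge0 _ w0) (le_trans (ltW x0)).
have bk : 2 * k * b + lam < 2 * (k - l - k * eps).
  have : (2 * k) * b < (2 * k) * (1 - l / k - lam / (2 * k) - eps).
    by rewrite ltr_pM2l // mulr_gt0.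
  have -> : 2 * k * (1 - l / k - lam / (2 * k) - eps) = 2 * (k - l - k * eps) - lam.
    by field; rewrite gt_eqF.
  lra.
(* One factor [x] of the quadratic term is replaced by [b * w], as [2 * k - lam] is positive; the
   term [- lam * (x * (b * w))] is then dropped, being nonpositive. *)
have i_le : 2 * i <= x * (2 * k * b + lam).
  rewrite -(ler_pM2r w0) (le_trans mix) //.
  have : (2 * k - lam) * (x * x) <= (2 * k - lam) * (x * (b * w)).
    by rewrite ler_wpM2l ?ler_wpM2l ?(ltW x0) // subr_ge0 ltW.
  have : 0 <= lam * (x * (b * w)) by rewrite !mulr_ge0 // ltW.
  lra.
have i_lt : 2 * i < x * (2 * (k - l - k * eps)).
  by rewrite (le_lt_trans i_le) // ltr_pM2l.
have m0 : 0 < 1 + (k - l) by lra.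
rewrite -(ltr_pM2r m0).
(* Here [1 <= l] enters. Combining [lowI] and [i_lt] gives [dd * (1 + (k - l)) > x + eps * x * k],
   which exceeds the left side. *)
have : eps * x * (1 + (k - l)) <= eps * x * k.
  by rewrite ler_wpM2l ?mulr_ge0 ?(ltW x0) //; lra.
lra.
Qed.

End Graph.

(** * Evolution of the faulty set over the rounds *)

Section Process.
Context {T : finType} {K : nat}.
Variables (L : nat) (V F : {set T}) (t : nat -> 'I_K -> seq T).

Lemma removed_sub_faulty r : removed L V F t r \subset faulty L V F t r.
Proof. by apply/subsetP => s; rewrite inE => /andP[]. Qed.

Lemma membersS r :
  members L V F t r.+1 = members L V F t r :\: removed L V F t r.
Proof. by rewrite /removed /members /faulty /=; case: (state _ _ _ _ r). Qed.

Lemma faultyS r :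
  faulty L V F t r.+1 = faulty L V F t r :\: removed L V F t r.
Proof. by rewrite /removed /members /faulty /=; case: (state _ _ _ _ r). Qed.

Lemma faulty_sub_members r :
  F \subset V -> faulty L V F t r \subset members L V F t r.
Proof.
move=> FV; elim: r => [//|r IHr]; rewrite faultyS membersS.
exact: setSD.
Qed.

Lemma card_faultyS r :
  #|faulty L V F t r.+1| = (#|faulty L V F t r| - #|removed L V F t r|)%N.
Proof. by rewrite faultyS cardsDS ?removed_sub_faulty. Qed.

Lemma card_removed_le_faulty r :
  (#|removed L V F t r| <= #|faulty L V F t r|)%N.
Proof. exact/subset_leq_card/removed_sub_faulty. Qed.

(* Deleting the same number of elements from both sets cannot increase the
   faulty fraction, since that fraction is at most 1. *)
Lemma faulty_fraction_le (R : realType) (beta : R) r :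
  F \subset V -> F != set0 -> #|F|%:R = beta * #|V|%:R ->
  #|faulty L V F t r|%:R <= beta * #|members L V F t r|%:R.
Proof.
move=> FV F0 FbV; have VF : (#|F| <= #|V|)%N by exact: subset_leq_card.
have V0 : 0 < #|V|%:R :> R by rewrite ltr0n (leq_trans _ VF) ?card_gt0.
have b1 : beta <= 1.
  by rewrite -(ler_pM2r V0) -FbV mul1r ler_nat.
elim: r => [|r IHr]; first by rewrite [leRHS](_ : _ = #|F|%:R).
have RV : removed L V F t r \subset members L V F t r.
  exact: subset_trans (removed_sub_faulty r) (faulty_sub_members r FV).
rewrite card_faultyS membersS cardsDS // !natrB ?card_removed_le_faulty ?subset_leq_card //.
rewrite mulrBr lerB //.
by rewrite ler_piMl.
Qed.

Lemma removed_gt (R : realType) (lam beta eps : R) r :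
  (1 <= L <= K)%N -> lam < (2 * K)%:R ->
  F \subset V -> F != set0 -> #|F|%:R = beta * #|V|%:R ->
  topologies_ok L lam V F t -> 0 <= eps ->
  beta < 1 - L%:R / K%:R - lam / (2 * K)%:R - eps ->
  faulty L V F t r != set0 ->
  eps * #|faulty L V F t r|%:R < #|removed L V F t r|%:R.
Proof.
move=> LK lamd FV F0 FbV tok eps0 blt Fr0; have [ringr sebr] := tok r Fr0.
apply: detected_gt LK lamd ringr _ Fr0 sebr _ eps0 blt.
  exact: faulty_sub_members.
exact: faulty_fraction_le.
Qed.

Lemma exists_faulty_eq0 :
  (forall r, faulty L V F t r != set0 -> removed L V F t r != set0) ->
  exists r, faulty L V F t r = set0.
Proof.
move=> progress.
(* At least one process leaves per round, so round [#|F|] serves as witness; the subtraction is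
   truncated at 0. *)
suff dec r : (#|faulty L V F t r| <= #|F| - r)%N.
  by exists #|F|; apply/eqP; rewrite -cards_eq0 -leqn0 -(subnn #|F|).
elim: r => [|r IHr]; first by rewrite subn0.
rewrite card_faultyS subnS.
have [F0|/progress] := eqVneq (faulty L V F t r) set0; first by rewrite F0 cards0.
by rewrite -card_gt0; lia.
Qed.

(** Each round multiplies the size by at most [1 - eps <= expR (- eps)]; an empty faulty set stays
    empty. *)
Lemma faulty_exp_decay (R : realType) (eps : R) r :
  (forall r, faulty L V F t r != set0 ->
     eps * #|faulty L V F t r|%:R <= #|removed L V F t r|%:R) ->
  #|faulty L V F t r|%:R <= expR (- eps * r%:R) * #|F|%:R.
Proof.
move=> progress; elim: r => [|r IHr]; first by rewrite mulr0 expR0 mul1r.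
have [F0|/progress prog] := eqVneq (faulty L V F t r) set0.
  by rewrite card_faultyS F0 cards0 mulr_ge0 ?expR_ge0.
rewrite -natr1 mulrDr mulr1 addrC expRD -mulrA.
apply: (@le_trans _ _ ((1 - eps) * #|faulty L V F t r|%:R)).
  by rewrite card_faultyS natrB ?card_removed_le_faulty // mulrBl mul1r lerB.
apply: (@le_trans _ _ (expR (- eps) * #|faulty L V F t r|%:R)).
  by rewrite ler_wpM2r // expR_ge1Dx.
by rewrite ler_wpM2l ?expR_ge0.
Qed.

Lemma faulty_eq0_log (R : realType) (eps : R) :
  0 < eps -> F != set0 ->
  (forall r, faulty L V F t r != set0 ->
     eps * #|faulty L V F t r|%:R <= #|removed L V F t r|%:R) ->
  exists r : nat, r%:R <= (1 + eps^-1) * (1 + ln #|F|%:R) /\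
    faulty L V F t r = set0.
Proof.
move=> eps0 F0 progress.
have F1 : 1 <= #|F|%:R :> R by rewrite ler1n card_gt0.
have lnF : 0 <= ln (#|F|%:R : R) by exact: ln_ge0.
have q0 : 0 <= ln (#|F|%:R : R) / eps by rewrite divr_ge0 // ltW.
(* The successor of the integer part strictly exceeds [ln #|F| / eps], so the exponential bound at
   this round is below 1 and the cardinality is 0. *)
exists (Num.truncn (ln (#|F|%:R : R) / eps)).+1; split.
  have := truncn_le (ln (#|F|%:R : R) / eps); rewrite q0 -natr1 => trunc_le.
  have e0 : 0 < eps^-1 by rewrite invr_gt0.
  (* The round is at most [1 + ln #|F| / eps], a sum of two of the four nonnegative terms in the
     expanded product. *)
  nra.
apply/eqP; rewrite -cards_eq0 -leqn0 -ltnS -(ltr_nat R).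
apply: le_lt_trans (faulty_exp_decay _ progress) _.
rewrite -[X in _ * X]lnK ?posrE ?(lt_le_trans ltr01) // -expRD expR_lt1.
have := truncnS_gt (ln (#|F|%:R : R) / eps).
rewrite ltr_pdivrMr //; lra.
Qed.

End Process.

Theorem mainTheorem2 (R : realType) :
  (forall (K L : nat) (lam beta : R) (T : finType) (V F : {set T})
          (t : nat -> 'I_K -> seq T),
     (1 <= L <= K)%N -> lam < (2 * K)%:R ->
     F \subset V -> F != set0 -> #|F|%:R = beta * #|V|%:R ->
     topologies_ok L lam V F t ->
     beta < 1 - L%:R / K%:R - lam / (2 * K)%:R ->
     (forall r : nat, faulty L V F t r != set0 ->
        removed L V F t r != set0) /\
     (exists r : nat, faulty L V F t r = set0))
  /\
  (forall eps : R, 0 < eps ->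
     exists c C : R, 0 < c /\
     forall (K L : nat) (lam beta : R) (T : finType) (V F : {set T})
            (t : nat -> 'I_K -> seq T),
       (1 <= L <= K)%N -> lam < (2 * K)%:R ->
       F \subset V -> F != set0 -> #|F|%:R = beta * #|V|%:R ->
       topologies_ok L lam V F t ->
       beta < 1 - L%:R / K%:R - lam / (2 * K)%:R - eps ->
       (forall r : nat, faulty L V F t r != set0 ->
          c * #|faulty L V F t r|%:R <= #|removed L V F t r|%:R) /\
       (exists r : nat, r%:R <= C * (1 + ln #|F|%:R) /\
          faulty L V F t r = set0)).
Proof.
split=> [|eps eps0].
  move=> K L lam beta T V F t LK lamd FV F0 FbV tok blt.
  have progress r : faulty L V F t r != set0 -> removed L V F t r != set0.
    move=> Fr0; rewrite -card_gt0 -(ltr_nat R) -[X in X < _](mul0r #|faulty L V F t r|%:R).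
    (* The case [eps = 0] of the strict bound. *)
    by apply: removed_gt LK lamd FV F0 FbV tok _ _ Fr0; rewrite ?subr0.
  by split=> //; apply: exists_faulty_eq0.
exists eps, (1 + eps^-1); split=> // K L lam beta T V F t LK lamd FV F0 FbV tok blt.
have progress r : faulty L V F t r != set0 ->
    eps * #|faulty L V F t r|%:R <= #|removed L V F t r|%:R.
  by move=> Fr0; apply/ltW/(removed_gt LK lamd FV F0 FbV tok (ltW eps0) blt Fr0).
by split=> //; apply: faulty_eq0_log.
Qed.
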